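(* Let $1\le p<\infty$. (i) For $\alpha>-\frac1p$ and $\lambda>0$, let $\xi_{\alpha,\lambda+1}(t):=t^\alpha e^{-(\lambda+1)t}$ for $t>0$. Then $$\xi_{\alpha,\lambda+1}=\sum_{n=0}^\infty\frac{\lambda^n}{(\lambda+1)^{n+\alpha+1}}\,\frac{\Gamma(n+\alpha+1)}{n!}\,\ell_n^{(\alpha)},$$ with the series converging in $L^p(\mathbb R_+)$. (ii) If $\alpha>-\frac1p$, the linear span of $\{\ell_n^{(\alpha)}: n\ge0\}$ is dense in $L^p(\mathbb R_+)$.
   Context: $L_n^{(\alpha)}(t)=\sum_{k=0}^n(-1)^k\binom{n+\alpha}{n-k}\frac{t^k}{k!}$ is the generalized Laguerre polynomial, and $\ell_n^{(\alpha)}(t):=\frac{n!}{\Gamma(n+\alpha+1)}t^{\alpha}e^{-t}L_n^{(\alpha)}(t)$ for $t>0$. *)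

(* Defs.v *)
From HB Require Import structures.
From mathcomp Require Import all_boot all_order all_algebra.
From mathcomp Require Import all_classical all_reals all_analysis.
Set Implicit Arguments. Unset Strict Implicit. Unset Printing Implicit Defensive.
Import Order.TTheory GRing.Theory Num.Theory.
Import numFieldNormedType.Exports.
Local Open Scope classical_set_scope.
Local Open Scope ring_scope.

Section Defs.
Variable R : realType.

Definition Rpos : set R := `]0, +oo[%classic.

Definition Gamma (s : R) : R :=
  fine (\int[@lebesgue_measure R]_(t in Rpos) ((t `^ (s - 1)) * expR (- t))%:E).

Definition gbinom (x : R) (m : nat) : R :=
  (\prod_(i < m) (x - i%:R)) / (m`!)%:R.

Definition laguerreL (n : nat) (alpha t : R) : R :=
  \sum_(k < n.+1) (-1) ^+ k * gbinom (n%:R + alpha) (n - k) * t ^+ k / (k`!)%:R.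

Definition laguerre_fn (n : nat) (alpha t : R) : R :=
  (n`!)%:R / Gamma (n%:R + alpha + 1) * t `^ alpha * expR (- t) * laguerreL n alpha t.

Definition xi (alpha c t : R) : R := t `^ alpha * expR (- (c * t)).

Definition Lp_int (p : R) (f : R -> R) : \bar R :=
  \int[@lebesgue_measure R]_(x in Rpos) (`|f x| `^ p)%:E.

Definition in_Lp (p : R) (f : R -> R) : Prop :=
  measurable_fun Rpos f /\ (Lp_int p f < +oo)%E.

End Defs.

(* Main.v *)
(** Since [L_n' = - (L_0 + ... + L_(n-1))], the derivative of
    [e^(-t) (L_0(t)^2 + ... + L_(n-1)(t)^2)] is [- e^(-t) (L_0 + ... + L_(n-1))^2],
    so this quantity decreases on [t >= 0]: up to a factor polynomial in [n], [L_n]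
    is bounded by [e^(t/2)], with no complex analysis.  For [z = lambda / (lambda + 1)]
    the partial sums [G_N] of [sum z^n L_n] satisfy
    [(e^(lambda t) G_N)' = e^(lambda t) (lambda + 1) z^N (L_0 + ... + L_(N-1))], and the
    mean value theorem bounds the remainder of the generating series by
    [eta_N e^(3t/4)] with [eta_N --> 0]; multiplied by [t^alpha e^(-t)] it tends to [0]
    in [L^p].  For the density, the closed span contains [t^alpha e^(-t) q(e^(-l t))] for
    every polynomial [q] and [l >= 0]; choosing [q = (1 - X^n)^(n 2^n)] it contains
    [t^alpha e^(-t) 1_(c, oo)], hence [t^alpha e^(-t) 1_A] for all Borel [A] by the
    pi-lambda theorem, hence all of [L^p] by simple approximation. *)

Require Import Defs.
From HB Require Import structures.
From mathcomp Require Import all_boot all_order all_algebra.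
From mathcomp Require Import all_classical all_reals all_analysis.
From mathcomp Require Import measurable_realfun ring lra.
Set Implicit Arguments. Unset Strict Implicit. Unset Printing Implicit Defensive.
Import Order.TTheory GRing.Theory Num.Theory.
Import numFieldNormedType.Exports.
Local Open Scope classical_set_scope.
Local Open Scope ring_scope.

(** * Generalized binomial coefficients *)

Section Gbinom.
Variable R : realType.
Implicit Types (x alpha : R) (n m k : nat).

Lemma gbinom0 x : gbinom x 0 = 1.
Proof. by rewrite /gbinom big_ord0 fact0 divr1. Qed.

Lemma gbinomSS x m : gbinom (x + 1) m.+1 = (x + 1) / m.+1%:R * gbinom x m.
Proof.
rewrite /gbinom big_ord_recl factS natrM subr0 -mulrA.
under eq_bigr => i _.
  have -> : x + 1 - (lift ord0 i)%:R = x - i%:R.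
    by rewrite /= /bump /= add1n -natr1; ring.
  over.
have h1 : m.+1%:R != 0 :> R by rewrite pnatr_eq0.
have h2 : (m`!)%:R != 0 :> R by rewrite pnatr_eq0 -lt0n fact_gt0.
by rewrite invfM; ring.
Qed.

Lemma gbinom_pascal x m : gbinom (x + 1) m.+1 = gbinom x m.+1 + gbinom x m.
Proof.
rewrite gbinomSS /gbinom big_ord_recr /= factS natrM.
have h1 : m.+1%:R != 0 :> R by rewrite pnatr_eq0.
have h2 : (m`!)%:R != 0 :> R by rewrite pnatr_eq0 -lt0n fact_gt0.
have h3 : m%:R + 1 != 0 :> R by rewrite natr1.
by rewrite -natr1; field; rewrite h2 h3.
Qed.

Lemma gbinom_diagS alpha n : gbinom (n.+1%:R + alpha) n.+1 =
  (1 + alpha / n.+1%:R) * gbinom (n%:R + alpha) n.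
Proof.
have -> : n.+1%:R + alpha = (n%:R + alpha) + 1 by rewrite -natr1; ring.
rewrite gbinomSS; congr (_ * _).
have h1 : n.+1%:R != 0 :> R by rewrite pnatr_eq0.
have h3 : n%:R + 1 != 0 :> R by rewrite natr1.
by rewrite -natr1; field.
Qed.

(** By [gbinom_diagS] consecutive terms have ratio [1 + alpha / n.+1]. For an integer [m >= |alpha|]
    this is at most [(n.+2 / n.+1) ^ m] in modulus, and the product of these bounds telescopes. *)
Lemma gbinom_diag_le alpha : exists m,
  forall n, `|gbinom (n%:R + alpha) n| <= n.+1%:R ^+ m.
Proof.
exists (Num.truncn `|alpha|).+1; set m := _.+1.
have am : `|alpha| <= m%:R by rewrite /m ltW// truncnS_gt.
elim=> [|n ih]; first by rewrite gbinom0 normr1 expr1n.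
rewrite gbinom_diagS normrM.
have -> : n.+2%:R ^+ m = (1 + (n.+1%:R)^-1) ^+ m * n.+1%:R ^+ m :> R.
  rewrite -exprMn; congr (_ ^+ _).
  rewrite mulrDl mul1r mulVf ?pnatr_eq0//.
  by rewrite -natr1.
apply: ler_pM => //.
have h : 0 <= (n.+1%:R : R)^-1 by rewrite invr_ge0.
apply: (@le_trans _ _ (1 + m%:R * (n.+1%:R)^-1)).
  rewrite (le_trans (ler_normD _ _))// normr1 lerD2l normrM (ger0_norm h).
  by rewrite ler_wpM2r.
(* Bernoulli's inequality for [1 + (n.+1)^-1]. *)
elim: {am ih}m => [|m ih]; first by rewrite mul0r addr0 expr0.
rewrite exprSr -natr1.
apply: (le_trans _ (ler_wpM2r (addr_ge0 ler01 h) ih)).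
rewrite -subr_ge0; set y := (n.+1%:R)^-1 in h *.
have -> : (1 + m%:R * y) * (1 + y) - (1 + (m%:R + 1) * y) = m%:R * (y * y) by ring.
by rewrite !mulr_ge0.
Qed.

End Gbinom.

(** * Algebraic identities between Laguerre polynomials *)

Section LaguerrePoly.
Variables (R : realType) (alpha : R).
Implicit Types (n k : nat) (t lambda : R).

Definition laguerre_poly n : {poly R} :=
  \poly_(k < n.+1) ((-1) ^+ k * gbinom (n%:R + alpha) (n - k) / (k`!)%:R).

Definition laguerre_psum n : {poly R} := \sum_(k < n) laguerre_poly k.

Lemma laguerre_polyE n t : (laguerre_poly n).[t] = laguerreL n alpha t.
Proof.
by rewrite horner_poly; apply: eq_bigr => i _; rewrite mulrAC.
Qed.

Lemma laguerre_poly0 n : (laguerre_poly n).[0] = gbinom (n%:R + alpha) n.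
Proof.
by rewrite horner_coef0 coef_poly /= expr0 mul1r subn0 fact0 divr1.
Qed.

(** Pascal's rule, coefficient by coefficient: the sum is the Laguerre polynomial of degree [n - 1]
    and parameter [alpha + 1]. For [n = 0] both sides are zero, so the value of [n.-1] there is
    harmless. *)
Lemma laguerre_psumE n : laguerre_psum n =
  \poly_(k < n) ((-1) ^+ k * gbinom (n%:R + alpha) (n.-1 - k) / (k`!)%:R).
Proof.
rewrite /laguerre_psum; elim: n => [|n ih].
  by rewrite big_ord0; apply/polyP => i; rewrite coef_poly coef0.
rewrite big_ord_recr /= ih; apply/polyP => i.
rewrite coefD !coef_poly ltnS.
have [ltin|] := ltnP i n; last first.
  rewrite leq_eqVlt => /orP[/eqP <-|ni].
    by rewrite leqnn subnn !gbinom0 add0r.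
  by rewrite leqNgt ni addr0.
rewrite (ltnW ltin).
have -> : n.+1%:R + alpha = (n%:R + alpha) + 1 by rewrite -natr1; ring.
have -> : (n - i = (n.-1 - i).+1)%N.
  by case: n ltin {ih} => //= n; rewrite ltnS => h; rewrite subSn.
rewrite gbinom_pascal; ring.
Qed.

Lemma deriv_laguerre_poly n : (laguerre_poly n)^`() = - laguerre_psum n.
Proof.
rewrite laguerre_psumE; apply/polyP => i; rewrite coefN coef_deriv !coef_poly ltnS.
have [ltin|_] := ltnP i n; last by rewrite mul0rn oppr0.
have -> : (n - i.+1 = n.-1 - i)%N by case: n ltin.
rewrite factS natrM exprS -mulr_natr.
have h1 : i.+1%:R != 0 :> R by rewrite pnatr_eq0.
have h2 : (i`!)%:R != 0 :> R by rewrite pnatr_eq0 -lt0n fact_gt0.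
by field; rewrite h2 /=.
Qed.

Lemma laguerre_psumS n : laguerre_psum n.+1 = laguerre_psum n + laguerre_poly n.
Proof. by rewrite /laguerre_psum big_ord_recr. Qed.

Definition laguerre_energy n : {poly R} := \sum_(k < n) laguerre_poly k ^+ 2.

(** Adding [L_n] contributes [- 2 * L_n * S_n] on the left, with [S_n] the sum of the earlier
    polynomials. On the right it contributes [L_n ^ 2 - (S_n + L_n) ^ 2 + S_n ^ 2], which is the
    same. *)
Lemma deriv_laguerre_energy n :
  (laguerre_energy n)^`() = laguerre_energy n - laguerre_psum n ^+ 2.
Proof.
rewrite /laguerre_energy; elim: n => [|n ih].
  by rewrite /laguerre_psum !big_ord0 deriv0 expr0n /= subr0.
rewrite !big_ord_recr /= derivD ih laguerre_psumS expr2 derivM deriv_laguerre_poly.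
ring.
Qed.

End LaguerrePoly.

(** * Exponential bounds for Laguerre polynomials on the half-line *)

Section Estimates.
Variables (R : realType).
Implicit Types (f df : R -> R) (n k N : nat) (t z lambda alpha : R).

Lemma MVT0 f df t : 0 <= t ->
  (forall x, 0 <= x <= t -> is_derive x 1 f (df x)) ->
  exists2 c, 0 <= c <= t & f t - f 0 = df c * t.
Proof.
move=> t0 dfx; have [| |c] := @MVT_segment R f df 0 t t0.
- by move=> x; rewrite in_itv /= => /andP[/ltW x0 /ltW xt]; apply: dfx; rewrite x0.
- apply: derivable_within_continuous => x; rewrite in_itv /= => /dfx h.
  exact: ex_derive.
by rewrite in_itv /= subr0; exists c.
Qed.

Lemma laguerre_energy_le alpha n t : 0 <= t ->
  (laguerre_energy alpha n).[t] <= expR t * (laguerre_energy alpha n).[0].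
Proof.
move=> t0; set E := laguerre_energy alpha n.
pose f (x : R) := expR (- x) * E.[x].
have dfE (x : R) : is_derive x 1 f (- (expR (- x) * (laguerre_psum alpha n).[x] ^+ 2)).
  rewrite /f; apply: trigger_derive.
  rewrite deriv_laguerre_energy -/E hornerD hornerN horner_exp.
  rewrite /GRing.scale/=; ring.
have [c _] := MVT0 t0 (fun x _ => dfE x).
rewrite /f oppr0 expR0 mul1r => h.
have : expR (- t) * E.[t] - E.[0] <= 0.
  by rewrite h mulNr oppr_le0 mulr_ge0// mulr_ge0 ?expR_ge0 ?sqr_ge0.
rewrite subr_le0 => le.
have -> : E.[t] = expR t * (expR (- t) * E.[t]).
  by rewrite mulrA -expRD subrr expR0 mul1r.
by rewrite ler_wpM2l ?expR_ge0.
Qed.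

(** With [e = expR (t / 2)] and [x = |L_i(t)|], the inequality [x * e <= e ^ 2 + x ^ 2] is summed
    over [i]. The energy bound makes the right side of order [e ^ 2], and division by [e] leaves the
    claim. *)
Lemma laguerre_psum_le alpha n t : 0 <= t ->
  `|(laguerre_psum alpha n).[t]| <=
    expR (t / 2) * (n%:R + (laguerre_energy alpha n).[0]).
Proof.
move=> t0; have e0 : 0 < expR (t / 2) := expR_gt0 _.
have eE : expR t = expR (t / 2) * expR (t / 2) by rewrite -expRD -splitr.
have -> : expR (t / 2) * (n%:R + (laguerre_energy alpha n).[0]) =
  (expR (t / 2) * expR (t / 2) * n%:R + expR t * (laguerre_energy alpha n).[0])
    / expR (t / 2).
  by rewrite eE; field; rewrite gt_eqF.
rewrite ler_pdivlMr//.
apply: (@le_trans _ _ (expR (t / 2) * expR (t / 2) * n%:R + (laguerre_energy alpha n).[t])); last first.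
  by rewrite lerD2l laguerre_energy_le.
move: (expR (t / 2)) e0 => e e0.
rewrite /laguerre_psum /laguerre_energy !horner_sum.
apply: (@le_trans _ _ ((\sum_(i < n) `|(laguerre_poly alpha i).[t]|) * e)).
  by rewrite ler_wpM2r ?ler_norm_sum// ltW.
have -> : e * e * n%:R = \sum_(i < n) (e * e).
  by rewrite sumr_const card_ord mulr_natr.
rewrite -big_split mulr_suml ler_sum// => i _.
rewrite horner_exp -(real_normK (num_real (laguerre_poly alpha i).[t])).
move: `|_| (normr_ge0 (laguerre_poly alpha i).[t]) => x x0 /=.
by have := sqr_ge0 (x - e); have := mulr_ge0 x0 (ltW e0); nra.
Qed.

(** * Partial sums of the generating series [sum z^n L_n] *)

Definition laguerre_gen alpha z N : {poly R} :=
  \sum_(n < N) z ^+ n *: laguerre_poly alpha n.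

(** This choice of [z] gives [(lambda + 1) * z ^ N.+1 = lambda * z ^ N], which makes the terms
    recombine into [- lambda] times the generating sum plus a single multiple of the sum of the
    [L_n]. *)
Lemma deriv_laguerre_gen alpha lambda N : 0 < lambda ->
  (laguerre_gen alpha (lambda / (lambda + 1)) N)^`() =
  ((lambda + 1) * (lambda / (lambda + 1)) ^+ N) *: laguerre_psum alpha N
  - lambda *: laguerre_gen alpha (lambda / (lambda + 1)) N.
Proof.
move=> l0; have l1 : lambda + 1 != 0 by rewrite gt_eqF// addr_gt0.
set z := lambda / _; rewrite /laguerre_gen; elim: N => [|N ih].
  by rewrite /laguerre_psum !big_ord0 deriv0 !scaler0 subrr.
rewrite !big_ord_recr /= derivD ih derivZ deriv_laguerre_poly laguerre_psumS.
have h : (lambda + 1) * z ^+ N.+1 = lambda * z ^+ N.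
  by rewrite exprS mulrA [X in X * _]mulrC divfK.
rewrite h !scalerDr scalerN -!mul_polyC !polyCM !polyCD.
ring.
Qed.

Lemma laguerre_gen_dist alpha lambda N t (z := lambda / (lambda + 1))
    (G := laguerre_gen alpha z N) : 0 < lambda -> 0 <= t ->
  `|G.[t] - expR (- (lambda * t)) * G.[0]| <=
    t * expR (t / 2) * ((lambda + 1) * z ^+ N * (N%:R + (laguerre_energy alpha N).[0])).
Proof.
move=> l0 t0.
have z0 : 0 <= z by rewrite divr_ge0 ?addr_ge0// ltW.
set S := laguerre_psum alpha N; set K := N%:R + _.
pose f (x : R) := expR (lambda * x) * G.[x].
have dfE (x : R) : is_derive x 1 f (expR (lambda * x) * ((lambda + 1) * z ^+ N * S.[x])).
  rewrite /f; apply: trigger_derive.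
  rewrite /G /z deriv_laguerre_gen// -/z -/G !hornerE /GRing.scale/=; ring.
have [c /andP[c0 ct]] := MVT0 t0 (fun x _ => dfE x).
rewrite /f mulr0 expR0 mul1r => h.
have -> : G.[t] - expR (- (lambda * t)) * G.[0] =
    expR (- (lambda * t)) * (expR (lambda * t) * G.[t] - G.[0]).
  by rewrite mulrBr mulrA -expRD addNr expR0 mul1r.
rewrite h !normrM (ger0_norm t0) !(ger0_norm (expR_ge0 _)).
rewrite (ger0_norm (exprn_ge0 _ z0)) (@ger0_norm _ (lambda + 1)) ?addr_ge0 ?(ltW l0)//.
have K0 : 0 <= K.
  rewrite /K addr_ge0// /laguerre_energy horner_sum sumr_ge0// => i _.
  by rewrite horner_exp sqr_ge0.
have A0 : 0 <= (lambda + 1) * z ^+ N.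
  by rewrite mulr_ge0 ?exprn_ge0// addr_ge0// ltW.
(* Both exponentials at the intermediate point [c] are enlarged to their values at [t], where
   [expR (lambda * t)] cancels the factor in front. *)
apply: (@le_trans _ _ (expR (- (lambda * t)) * (expR (lambda * t) *
   ((lambda + 1) * z ^+ N * (expR (t / 2) * K)) * t))).
  rewrite ler_wpM2l ?expR_ge0// ler_wpM2r//.
  apply: ler_pM; [exact: expR_ge0|exact: mulr_ge0| |].
    by rewrite ler_expR ler_wpM2l// ltW.
  rewrite ler_wpM2l//.
  apply: (le_trans (laguerre_psum_le _ _ c0)).
  by rewrite ler_wpM2r// ler_expR ler_wpM2r.
rewrite le_eqVlt; apply/orP; left; apply/eqP.
by rewrite !mulrA -expRD addNr expR0; ring.
Qed.

(** * Geometric decay against polynomial growth *)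

Lemma expn_geometric_bounded k z : 0 < z < 1 ->
  exists C, forall n, n.+1%:R ^+ k * z ^+ n <= C.
Proof.
elim: k z => [|k ih] z /andP[z0 z1].
  exists 1 => n; rewrite expr0 mul1r exprn_ile1 ?ltW//.
have s01 : 0 < Num.sqrt z < 1.
  by rewrite sqrtr_gt0 z0 /= -[ltRHS]sqrtr1 ltr_sqrt.
(* One copy of [s ^ n], with [s] the square root of [z], absorbs a single factor [n.+1]; the other
   copy is left to the induction hypothesis. *)
have zE : z = Num.sqrt z * Num.sqrt z by rewrite -expr2 sqr_sqrtr ?ltW.
move/ih : (s01) => [C hC]; move: s01 zE; set s := Num.sqrt z => /andP[s0 s1] zE.
(* [s ^ n] is the least term of [1 + s + ... + s ^ n = (1 - s ^ n.+1) / (1 - s)]. *)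
have bern n : n.+1%:R * s ^+ n <= (1 - s)^-1.
  rewrite -[leRHS]mul1r ler_pdivlMr ?subr_gt0//.
  apply: (@le_trans _ _ (1 - s ^+ n.+1)); last by rewrite gerBl exprn_ge0 ?ltW.
  elim: n => [|n IH]; first by rewrite mul1r mul1r.
  have sn : s ^+ n.+1 <= 1 by rewrite exprn_ile1 ?ltW.
  have h : s * (n.+1%:R * s ^+ n * (1 - s)) <= s * (1 - s ^+ n.+1).
    by rewrite ler_wpM2l// ltW.
  rewrite -natr1 [in leRHS]exprS.
  have -> : (n.+1%:R + 1) * s ^+ n.+1 * (1 - s) =
      s * (n.+1%:R * s ^+ n * (1 - s)) + s ^+ n.+1 * (1 - s) by rewrite exprS; ring.
  move: h; move: (s * (_ * _ * _)) => X; nra.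
exists (C * (1 - s)^-1) => n; rewrite zE exprMn exprSr.
have -> : n.+1%:R ^+ k * n.+1%:R * (s ^+ n * s ^+ n) = (n.+1%:R ^+ k * s ^+ n) * (n.+1%:R * s ^+ n) by ring.
by apply: ler_pM; rewrite ?mulr_ge0 ?exprn_ge0// ?(ltW s0).
Qed.

Lemma expn_geometric_cvg0 k z : 0 < z < 1 ->
  (fun n => n.+1%:R ^+ k * z ^+ n) @ \oo --> 0.
Proof.
move=> /andP[z0 z1].
have [s0 s1] : 0 < Num.sqrt z /\ Num.sqrt z < 1.
  by split; rewrite ?sqrtr_gt0// -[ltRHS]sqrtr1 ltr_sqrt.
have zE : z = Num.sqrt z * Num.sqrt z by rewrite -expr2 sqr_sqrtr ?ltW.
have [|C hC] := @expn_geometric_bounded k (Num.sqrt z); first by rewrite s0.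
move: s0 s1 zE hC; set s := Num.sqrt z => s0 s1 zE hC.
apply: (@squeeze_cvgr _ _ _ _ (fun=> 0) (fun n => C * s ^+ n)).
- near=> n; apply/andP; split.
    by rewrite mulr_ge0 ?exprn_ge0// ltW.
  by rewrite zE exprMn mulrA ler_wpM2r ?exprn_ge0// ltW.
- exact: cvg_cst.
- rewrite -[X in _ --> X](mulr0 C); apply: cvgMr => //.
  by apply: cvg_expr; rewrite ger0_norm// ltW.
Unshelve. all: by end_near. Qed.

(** * The binomial series for the power [- (alpha + 1)] of [1 - z] *)

Definition binomial_psum alpha N : {poly R} :=
  \poly_(n < N) gbinom (n%:R + alpha) n.

Lemma binomial_psumS alpha N : binomial_psum alpha N.+1 =
  binomial_psum alpha N + gbinom (N%:R + alpha) N *: 'X^N.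
Proof. by rewrite /binomial_psum !poly_def big_ord_recr. Qed.

(** The full series solves [(1 - x) * y' = (alpha + 1) * y]; its truncation solves this equation up
    to one monomial. *)
Lemma deriv_binomial_psum alpha N (B := binomial_psum alpha N.+1) :
  (1 - 'X) * B^`() = (alpha + 1) *: B
    - (N.+1%:R * gbinom (N.+1%:R + alpha) N.+1) *: 'X^N.
Proof.
rewrite {}/B; elim: N => [|N ih].
  have B0 : binomial_psum alpha 0 = 0.
    by apply/polyP => i; rewrite coef_poly coef0.
  rewrite binomial_psumS B0.
  rewrite add0r gbinom_diagS !gbinom0 divr1 expr0 !alg_polyC derivC mulr0 mul1r mulr1.
  by rewrite [alpha + 1]addrC subrr.
rewrite binomial_psumS derivD mulrDr ih derivZ derivXn /=.
have -> : N.+2%:R * gbinom (N.+2%:R + alpha) N.+2 =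
    (N.+2%:R + alpha) * gbinom (N.+1%:R + alpha) N.+1.
  rewrite [gbinom (N.+2%:R + alpha) N.+2]gbinom_diagS mulrA; congr (_ * _).
  by rewrite mulrDr mulr1 mulrCA mulfV ?pnatr_eq0// mulr1.
move: (gbinom _ _) (binomial_psum _ _) => b B.
rewrite -scaler_nat -!mul_polyC !polyCM exprS -!natr1 !polyCD.
ring.
Qed.

(** By the equation above, the derivative of the product in [z] reduces to the truncation monomial.
    The mean value theorem from [0], where the product is [1], then leaves an error of a power of
    [N.+1] times [z ^ N]. *)
Lemma binomial_series alpha z : 0 < z < 1 ->
  (fun N => (1 - z) `^ (alpha + 1) * (binomial_psum alpha N).[z]) @ \oo --> (1 : R).
Proof.
(* The empty partial sum has value [0] at the origin; from one term on the value is [1]. *)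
move=> /andP[z0 z1]; rewrite -cvg_shiftS /=.
have [m hm] := @gbinom_diag_le R alpha.
(* [K] bounds the power [alpha] of [1 - x] for [0 <= x <= z]: the maximum is at [x = 0] if
   [alpha >= 0], and at [x = z] otherwise. *)
pose K := 1 + (1 - z) `^ alpha.
have K0 : 0 <= K by rewrite addr_ge0// powR_ge0.
apply/cvgrPdist_le => e e0.
have : (fun n => K * 2 ^+ m.+1 * (n.+1%:R ^+ m.+1 * z ^+ n)) @ \oo --> 0.
  rewrite -[X in _ --> X](mulr0 (K * 2 ^+ m.+1)); apply: cvgMr => //.
  by apply: expn_geometric_cvg0; rewrite z0.
move=> /cvgrPdist_le/(_ _ e0); apply: filterS => N.
rewrite sub0r normrN => /(le_trans (ler_norm _)); apply: le_trans.
set B := binomial_psum alpha N.+1; set b := N.+1%:R * gbinom (N.+1%:R + alpha) N.+1.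
pose f (x : R) := (1 - x) `^ (alpha + 1) * B.[x].
have dfE (x : R) : 0 <= x <= z -> is_derive x 1 f (- ((1 - x) `^ alpha * (b * x ^+ N))).
  move=> /andP[x0 xz]; have x1 : 0 < 1 - x by rewrite subr_gt0 (le_lt_trans xz).
  have d1 : is_derive x 1 (fun y : R => (1 - y) `^ (alpha + 1))
      (- ((alpha + 1) * (1 - x) `^ alpha)).
    have := @is_derive1_comp _ (fun y : R => y `^ (alpha + 1)) (fun y : R => 1 - y)
      x _ _ (is_derive1_powR (alpha + 1) x1) _.
    move=> /(_ (0 - 1) _)/trigger_derive; apply.
    by rewrite addrK sub0r mulrN1.
  rewrite /f; apply: trigger_derive.
  have := congr1 (fun p : {poly R} => p.[x]) (deriv_binomial_psum alpha N).
  rewrite /= -/B -/b !hornerE => hB.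
  have pE : (1 - x) `^ (alpha + 1) = (1 - x) `^ alpha * (1 - x).
    rewrite powRD; first by rewrite powRr1// ltW.
    by rewrite (gt_eqF x1) implybT.
  rewrite /GRing.scale/= pE.
  transitivity ((1 - x) `^ alpha * ((1 - x) * B^`().[x] - (alpha + 1) * B.[x])); first by ring.
  by rewrite hB /b /gbinom; ring.
have [c /andP[c0 cz]] := MVT0 (ltW z0) dfE.
rewrite /f subr0 powR1 mul1r.
have -> : B.[0] = 1 by rewrite horner_coef0 coef_poly /= gbinom0.
have bb : `|b| <= 2 ^+ m.+1 * N.+1%:R ^+ m.+1.
  rewrite /b normrM ger0_norm// -exprMn exprS ler_pM//.
    by rewrite -[leLHS]mul1r ler_wpM2r// ler1n.
  apply: (le_trans (hm _)); rewrite lerXn2r ?nnegrE ?mulr_ge0//.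
  by rewrite -natrM ler_nat mul2n -addnn addSnnS leq_addl.
clearbody b => h; rewrite distrC h normrM normrN !normrM.
have zp : 0 < 1 - z by rewrite subr_gt0.
have zc : 1 - z <= 1 - c by rewrite lerD2l lerN2.
have cp : 0 < 1 - c := lt_le_trans zp zc.
have Kc : (1 - c) `^ alpha <= K.
  have [a0|a0] := leP 0 alpha.
    apply: (@le_trans _ _ (1 `^ alpha)); last by rewrite powR1 lerDl powR_ge0.
    by rewrite ge0_ler_powR ?nnegrE ?gerBl// ltW.
  apply: (@le_trans _ _ ((1 - z) `^ alpha)); last by rewrite lerDr.
  rewrite -(opprK alpha) !(powRN _ (- alpha)) lef_pV2 ?posrE ?powR_gt0//.
  by rewrite ge0_ler_powR ?nnegrE ?oppr_ge0 ?(ltW zp) ?(ltW cp)// ltW.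
rewrite (ger0_norm (powR_ge0 _ _)) (ger0_norm (exprn_ge0 _ c0)) (ger0_norm (ltW z0)).
have cN : c ^+ N <= z ^+ N by rewrite lerXn2r ?nnegrE ?(ltW z0).
have -> : K * 2 ^+ m.+1 * (N.+1%:R ^+ m.+1 * z ^+ N) =
  K * (2 ^+ m.+1 * N.+1%:R ^+ m.+1 * z ^+ N) * 1 by ring.
rewrite ler_pM ?(ltW z0) ?(ltW z1)//.
  by rewrite !mulr_ge0 ?powR_ge0 ?exprn_ge0.
by rewrite ler_pM ?powR_ge0 ?mulr_ge0 ?exprn_ge0// ler_pM ?exprn_ge0.
Qed.

(** * Remainder of the generating series, uniform up to an exponential weight *)

Lemma laguerre_gen0 alpha z N : (laguerre_gen alpha z N).[0] = (binomial_psum alpha N).[z].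
Proof.
rewrite /laguerre_gen horner_sum horner_poly; apply: eq_bigr => i _.
by rewrite hornerZ laguerre_poly0 mulrC.
Qed.

(** The values at [0] are diagonal binomials. Squaring doubles their growth exponent and the number
    of terms adds one, so the constant of [laguerre_gen_dist] stays polynomial in [N] and is beaten
    by [z ^ N]. *)
Lemma laguerre_energy0_le alpha : exists m, forall N,
  N%:R + (laguerre_energy alpha N).[0] <= 2 * N.+1%:R ^+ m.
Proof.
have [m hm] := @gbinom_diag_le R alpha; exists (m + m).+1 => N.
rewrite mulrDl mul1r lerD//.
  apply: (@le_trans _ _ N.+1%:R); first by rewrite ler_nat.
  by rewrite exprS ler_peMr// exprn_ege1// ler1n.
rewrite /laguerre_energy horner_sum.
apply: (@le_trans _ _ (\sum_(i < N) N.+1%:R ^+ (m + m))).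
  apply: ler_sum => i _; rewrite horner_exp laguerre_poly0 -real_normK ?num_real//.
  rewrite expr2 exprD; apply: ler_pM => //;
  by rewrite (le_trans (hm _))// lerXn2r ?nnegrE// ler_nat ltnS ltnW.
by rewrite sumr_const card_ord exprS -[leLHS]mulr_natl ler_wpM2r ?exprn_ge0// ler_nat.
Qed.

Lemma laguerre_gen_cvg alpha lambda (z := lambda / (lambda + 1)) : 0 < lambda ->
  exists2 eta : nat -> R, eta @ \oo --> 0 & forall N t, 0 <= t ->
    `|expR (- (lambda * t)) - (lambda + 1) `^ (- (alpha + 1)) * (laguerre_gen alpha z N).[t]|
    <= eta N * expR (3 / 4 * t).
Proof.
move=> l0; have l1 : 0 < lambda + 1 by rewrite addr_gt0.
have z01 : 0 < z < 1.
  by rewrite divr_gt0//= ltr_pdivrMr// mul1r ltrDl.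
have z0 : 0 <= z by case/andP: z01 => /ltW.
(* Since [1 - z = (lambda + 1)^-1], the normalizing constant is the one of the binomial series. *)
have cE : (lambda + 1) `^ (- (alpha + 1)) = (1 - z) `^ (alpha + 1).
  have -> : 1 - z = (lambda + 1)^-1 by rewrite /z; field; rewrite gt_eqF.
  by rewrite -powR_inv1 ?ltW// -powRrM mulN1r.
rewrite cE; set c := (1 - z) `^ _.
have c0 : 0 <= c by exact: powR_ge0.
have [m hm] := laguerre_energy0_le alpha.
exists (fun N => `|c * (binomial_psum alpha N).[z] - 1| +
   c * 4 * (lambda + 1) * 2 * (N.+1%:R ^+ m * z ^+ N)).
  rewrite -[X in _ --> X](addr0 0); apply: cvgD.
    apply/norm_cvg0P; rewrite -[X in _ --> X](subrr 1).
    by apply: cvgB; [exact: binomial_series|exact: cvg_cst].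
  rewrite -[X in _ --> X](mulr0 (c * 4 * (lambda + 1) * 2)); apply: cvgMr => //.
  exact: expn_geometric_cvg0.
move=> N t t0.
set G := laguerre_gen alpha z N.
(* The error at [t = 0], controlled by the binomial series, is separated from the deviation
   controlled by [laguerre_gen_dist]. *)
have -> : expR (- (lambda * t)) - c * G.[t] =
  - (expR (- (lambda * t)) * (c * G.[0] - 1)) - c * (G.[t] - expR (- (lambda * t)) * G.[0]) by ring.
rewrite (le_trans (ler_normB _ _))// mulrDl lerD//.
  rewrite normrN normrM /G laguerre_gen0 mulrC ler_wpM2l//.
  rewrite ger0_norm ?expR_ge0// ler_expR (@le_trans _ _ 0)//.
    by rewrite oppr_le0 mulr_ge0// ltW.
  by rewrite mulr_ge0.
rewrite normrM (ger0_norm c0).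
(* Absorbing the factor [t] costs a quarter in the exponent, by [t / 4 <= expR (t / 4)]. *)
have te : t * expR (t / 2) <= 4 * expR (3 / 4 * t).
  have -> : 3 / 4 * t = t / 4 + t / 2 by field.
  rewrite expRD mulrA ler_wpM2r ?expR_ge0//.
  have := expR_ge1Dx (t / 4); lra.
apply: (le_trans (ler_wpM2l c0 (laguerre_gen_dist _ _ l0 t0))).
rewrite -/z.
have -> : c * 4 * (lambda + 1) * 2 * (N.+1%:R ^+ m * z ^+ N) * expR (3 / 4 * t) =
  c * ((4 * expR (3 / 4 * t)) * ((lambda + 1) * z ^+ N * (2 * N.+1%:R ^+ m))) by ring.
have A0 : 0 <= (lambda + 1) * z ^+ N by rewrite mulr_ge0 ?exprn_ge0// ltW.
rewrite ler_wpM2l// ler_pM//.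
- by rewrite mulr_ge0 ?expR_ge0.
- rewrite mulr_ge0// addr_ge0// /laguerre_energy horner_sum sumr_ge0// => i _.
  by rewrite horner_exp sqr_ge0.
- by rewrite ler_wpM2l.
Qed.

(** A single [L_n] is the difference of two consecutive partial sums, each bounded by
    [laguerre_psum_le]. *)
Lemma laguerreL_le alpha n : exists2 C, 0 <= C &
  forall t, 0 <= t -> `|laguerreL n alpha t| <= C * expR (t / 2).
Proof.
pose K k := k%:R + (laguerre_energy alpha k).[0].
have K0 k : 0 <= K k.
  rewrite addr_ge0// /laguerre_energy horner_sum sumr_ge0// => i _.
  by rewrite horner_exp sqr_ge0.
exists (K n.+1 + K n); first exact: addr_ge0.
move=> t t0; rewrite -laguerre_polyE.
have -> : laguerre_poly alpha n = laguerre_psum alpha n.+1 - laguerre_psum alpha n.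
  by rewrite laguerre_psumS addrC addKr.
rewrite hornerD hornerN (le_trans (ler_normB _ _))// mulrC mulrDr.
by rewrite lerD// laguerre_psum_le.
Qed.

End Estimates.

(** * Integrability of [xi] on the half-line *)

Section LaplaceIntegral.
Variable R : realType.
Implicit Types (a b c t s alpha p k : R) (f g : R -> R).
Local Notation mu := (@lebesgue_measure R).

Lemma RposP t : Rpos t <-> 0 < t.
Proof. by rewrite /Rpos /= in_itv /= andbT. Qed.

Lemma measurable_Rpos : measurable (@Rpos R).
Proof. exact: measurable_itv. Qed.

Lemma measurable_xi alpha c : measurable_fun (@Rpos R) (xi alpha c).
Proof.
apply: measurable_funTS; apply: measurable_funM => //.
apply: measurableT_comp => //.
by apply: measurableT_comp => //; exact: mulrl_measurable.
Qed.

Lemma bigcup_itv_Rpos : \bigcup_i `[(i.+1%:R)^-1, i.+1%:R]%classic = @Rpos R.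
Proof.
apply/seteqP; split => [x [i _]|x].
  rewrite /= in_itv /= => /andP[ix _]; apply/RposP.
  by apply: lt_le_trans ix; rewrite invr_gt0.
(* An integer above [x + x^-1] is above both [x] and [x^-1]. *)
move=> /RposP x0; exists (Num.truncn (x + x^-1)) => //=; rewrite in_itv /=.
have xi0 : 0 < x^-1 by rewrite invr_gt0.
have h := truncnS_gt (x + x^-1).
rewrite -[X in _ <= X <= _]invrK lef_pV2 ?posrE ?invr_gt0 ?invrK//.
by rewrite !(le_trans _ (ltW h))// ?lerDl ?lerDr// ltW.
Qed.

(** The inequality [u <= expR u] at [u = c * t / b], raised to the power [b]. *)
Lemma powR_le_expR b c t : 0 < b -> 0 < c -> 0 < t ->
  t `^ b <= (b / c) `^ b * expR (c * t).
Proof.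
move=> b0 c0 t0.
have -> : expR (c * t) = expR (c * t / b) `^ b.
  by rewrite -expRM divfK// gt_eqF.
have bc0 : 0 <= b / c by rewrite divr_ge0// ltW.
rewrite -powRM ?expR_ge0//; apply: ge0_ler_powR; rewrite ?nnegrE ?(ltW b0) ?(ltW t0)//.
  by rewrite mulr_ge0 ?expR_ge0.
have tE : t = (b / c) * (c * t / b) by field; rewrite !gt_eqF.
rewrite [leLHS]tE ler_pM2l ?divr_gt0//.
by apply: le_trans (expR_ge1Dx _); rewrite lerDr.
Qed.

Lemma measurable_logistic b :
  measurable_fun [set: R] (fun t => b * t `^ (b - 1) * (1 + t `^ b) ^- 2).
Proof.
apply: measurable_funM.
  exact: measurable_funM.
under eq_fun do rewrite -powR_invn ?addr_ge0 ?powR_ge0//.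
apply: (@measurableT_comp _ _ _ _ _ _ (fun x : R => x `^ (- 2%:R))) => //.
exact: measurable_funD.
Qed.

(* The integrand is the derivative of [- (1 + t `^ b)^-1], which is bounded near both
   [0] and [+oo]; it serves as the majorant of [t `^ (b - 1) * expR (- (c * t))]. *)
Lemma integral_logistic_derivative_lt_pinfty b : 0 < b ->
  (\int[mu]_(t in @Rpos R) (b * t `^ (b - 1) * (1 + t `^ b) ^- 2)%:E < +oo)%E.
Proof.
move=> b0; pose f t := b * t `^ (b - 1) * (1 + t `^ b) ^- 2.
pose F t := - (1 + t `^ b)^-1.
have E t : 0 < 1 + t `^ b by rewrite ltr_pwDl// powR_ge0.
have dF t : 0 < t -> is_derive t 1 F (f t).
  move=> t0; rewrite /F.
  have dt : is_derive t 1 (fun y => 1 + y `^ b) (0 + b * t `^ (b - 1)) .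
    by apply: is_deriveD; exact: is_derive1_powR.
  have := is_deriveN 
    (@is_deriveV _ (fun y : R => 1 + y `^ b) t _ 1 (lt0r_neq0 (E t)) dt).
  move=> /trigger_derive; apply; rewrite add0r /f /GRing.scale /=; ring.
have df t : 0 < t -> derivable f t 1.
  move=> t0.
  have fE : f = (cst b * (fun y : R => y `^ (b - 1))) * (F * F).
    by apply/funext => y; rewrite /f /F /= !fctE /=; field; rewrite gt_eqF.
  have d1 : derivable (fun y : R => y `^ (b - 1)) t 1.
    by apply: ex_derive; exact: is_derive1_powR.
  have d2 : derivable F t 1 by apply: ex_derive; exact: dF.
  have d3 : derivable (F * F) t 1 := derivableM d2 d2.
  have d4 : derivable (cst b * (fun y : R => y `^ (b - 1))) t 1 := derivableM (derivable_cst _ _ _) d1.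
  by rewrite fE; exact: (derivableM d4 d3).
have f0 t : 0 <= f t.
  by rewrite mulr_ge0 ?invr_ge0 ?exprn_ge0 ?(ltW (E _))// mulr_ge0 ?powR_ge0// ltW.
have mf D : measurable_fun D (EFin \o f).
  by apply: measurable_funTS; apply/measurable_EFinP; exact: measurable_logistic.
apply: (@le_lt_trans _ _ 1%:E); last exact: ltry.
(* Monotone convergence along compact intervals that avoid [0], on which the fundamental theorem of
   calculus applies. *)
pose J (i : nat) : set R := `[(i.+1%:R)^-1, i.+1%:R]%classic.
rewrite -bigcup_itv_Rpos -[X in (integral _ X _)]/(\bigcup_i J i).
have mJ i : measurable (J i) by exact: measurable_itv.
have nd : nondecreasing_seq J.
  move=> i j ij; apply/subsetPset => x; rewrite /J /= !in_itv /= => /andP[ix xi].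
  by rewrite (le_trans _ ix) ?(le_trans xi) ?lef_pV2 ?posrE ?ler_nat.
have cv : (\int[mu]_(t in J i) (f t)%:E @[i --> \oo] -->
    \int[mu]_(t in \bigcup_i J i) (f t)%:E)%E.
  apply: ge0_nondecreasing_set_cvg_integral; [exact: nd|exact: mJ| |].
    by move=> i; exact: mf.
  by move=> i t _; rewrite lee_fin.
rewrite -(cvg_lim _ cv)//; apply: lime_le.
  by apply/cvg_ex; eexists; exact: cv.
apply: nearW => i.
have i0 : 0 < (i.+1%:R : R)^-1 by rewrite invr_gt0.
(* The interval of index [0] is the single point [1] and is treated apart. *)
have [i1|i1] := leP (i.+1%:R : R) (i.+1%:R)^-1.
  have i1' : i = 0%N.
    case: i i1 {i0} => // i; rewrite leNgt => /negP[].
    by rewrite (@lt_le_trans _ _ 1) ?ler1n// invf_lt1// ltr1n.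
  by rewrite /J i1' invr1 set_itv1 integral_set1 lee_fin.
have cF t : 0 < t -> {for t, continuous F}.
  move=> /dF dFt; apply/differentiable_continuous/derivable1_diffP.
  exact: ex_derive.
have tgt (t u : R) : t \in `]u^-1, u[ -> 0 < u -> 0 < t.
  by rewrite in_itv/= => /andP[+ _] u0; apply: lt_trans; rewrite invr_gt0.
rewrite /J (@continuous_FTC2 _ f F)//.
- rewrite -EFinB lee_fin /F opprK addrC lerBlDr.
  rewrite (@le_trans _ _ 1)// ?lerDl ?invr_ge0 ?(ltW (E _))//.
  by rewrite invf_le1// lerDl powR_ge0.
- apply: derivable_within_continuous => t; rewrite in_itv/= => /andP[it _].
  by apply: df; exact: lt_le_trans it.
- split.
  + by move=> t /tgt/(_ (ltr0Sn _ _))/dF dFt; exact: ex_derive.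
  + by apply: cvg_at_right_filter; exact: cF.
  + by apply: cvg_at_left_filter; exact: cF.
- move=> t /tgt/(_ (ltr0Sn _ _))/dF h.
  by rewrite derive1E derive_val.
Qed.

(** With [b = a + 1], both [1] and the power [b] of [t] are bounded by multiples of
    [expR (c / 2 * t)]. Squaring the resulting bound for [expR (- (c / 2 * t))] yields the logistic
    majorant times [D ^ 2 / b]. *)
Lemma integral_xi_lt_pinfty a c : -1 < a -> 0 < c ->
  (\int[mu]_(t in @Rpos R) (xi a c t)%:E < +oo)%E.
Proof.
move=> a1 c0; set b := a + 1; have b0 : 0 < b by rewrite /b; lra.
pose D := 1 + (b / (c / 2)) `^ b.
have D0 : 0 <= D by rewrite addr_ge0// powR_ge0.
have key t : 0 < t -> xi a c t <= (D ^+ 2 / b) * (b * t `^ (b - 1) * (1 + t `^ b) ^- 2).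
  move=> t0; rewrite /xi (_ : b - 1 = a); last by rewrite /b addrK.
  have E0 : 0 < 1 + t `^ b by rewrite ltr_pwDl// powR_ge0.
  have -> : D ^+ 2 / b * (b * t `^ a * (1 + t `^ b) ^- 2) = t `^ a * (D / (1 + t `^ b)) ^+ 2.
    by field; rewrite !gt_eqF.
  rewrite ler_wpM2l ?powR_ge0//.
  have -> : expR (- (c * t)) = (expR (- (c / 2 * t))) ^+ 2.
    by rewrite expr2 -expRD; congr expR; field.
  rewrite lerXn2r ?nnegrE ?expR_ge0 ?divr_ge0 ?(ltW E0)//.
  rewrite ler_pdivlMr// expRN mulrC ler_pdivrMr ?expR_gt0//.
  rewrite /D mulrDl mul1r lerD//; first by apply: le_trans (expR_ge1Dx _); rewrite lerDl mulr_ge0 ?divr_ge0// ltW.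
  by apply: powR_le_expR => //; rewrite divr_gt0.
have ig := integral_logistic_derivative_lt_pinfty b0.
have mf : measurable_fun (@Rpos R) (fun t => b * t `^ (b - 1) * (1 + t `^ b) ^- 2).
  apply: measurable_funTS; exact: measurable_logistic.
apply: (@le_lt_trans _ _ (\int[mu]_(t in @Rpos R)
    ((D ^+ 2 / b)%:E * (b * t `^ (b - 1) * (1 + t `^ b) ^- 2)%:E))%E).
  apply: ge0_le_integral; first exact: measurable_Rpos.
  - by move=> t _; rewrite lee_fin mulr_ge0 ?powR_ge0 ?expR_ge0.
  - by apply/measurable_EFinP; exact: measurable_xi.
  - by apply: measurable_funeM; exact/measurable_EFinP.
  - by move=> t /RposP t0; rewrite -EFinM lee_fin key.
rewrite ge0_integralZl//.
- by rewrite lte_mul_pinfty// lee_fin divr_ge0 ?exprn_ge0 ?(ltW b0).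
- exact: measurable_Rpos.
- exact/measurable_EFinP.
- move=> t _; rewrite lee_fin mulr_ge0 ?invr_ge0 ?exprn_ge0 ?addr_ge0 ?powR_ge0//.
  by rewrite mulr_ge0 ?powR_ge0// ltW.
- by rewrite lee_fin divr_ge0 ?exprn_ge0 ?(ltW b0).
Qed.

End LaplaceIntegral.

(** * Positivity of [Gamma], and calculus with the [p]-th power integral *)

Section LpInt.
Variables (R : realType) (p : R).
Hypothesis p1 : 1 <= p.
Implicit Types (a b c t s alpha k eps : R) (f g : R -> R).
Local Notation mu := (@lebesgue_measure R).

(** [fine] sends [+oo] to [0], so the integral must be shown finite as well as nonzero. If it
    vanished, the positive integrand would be zero almost everywhere on a set of infinite
    measure. *)
Lemma Gamma_gt0 s : 0 < s -> 0 < Gamma s.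
Proof.
move=> s0; rewrite /Gamma.
have eq_xi : (\int[mu]_(t in @Rpos R) (t `^ (s - 1) * expR (- t))%:E =
    \int[mu]_(t in @Rpos R) (xi (s - 1) 1 t)%:E)%E.
  by apply: eq_integral => t _; rewrite /xi mul1r.
rewrite eq_xi; apply: fine_gt0; apply/andP; split; last first.
  by apply: integral_xi_lt_pinfty => //; rewrite ltrBrDr addNr.
rewrite lt_neqAle integral_ge0 ?andbT; last first.
  by move=> t _; rewrite lee_fin mulr_ge0 ?powR_ge0 ?expR_ge0.
apply/eqP => I0.
have mxi : measurable_fun (@Rpos R) (EFin \o xi (s - 1) 1).
  by apply/measurable_EFinP; exact: measurable_xi.
have /(ae_eq_integral_abs mu (@measurable_Rpos R) mxi) : (\int[mu]_(t in @Rpos R) `|(EFin \o xi (s - 1) 1) t| = 0)%E.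
  rewrite I0; apply: eq_integral => t _ /=.
  by rewrite ger0_norm// mulr_ge0 ?powR_ge0 ?expR_ge0.
move=> [A [mA A0 sub]].
have : (mu (@Rpos R) <= mu A)%E.
  apply: le_measure; rewrite ?inE//; first exact: measurable_Rpos.
  move=> t /[dup] Rt /RposP t0; apply: sub => /= /(_ Rt)/eqP.
  by rewrite eqe; apply/negP; rewrite gt_eqF// mulr_gt0 ?powR_gt0 ?expR_gt0.
by rewrite A0 /Rpos lebesgue_measure_itv /= ltry.
Qed.

Let p0 : 0 < p. Proof. exact: lt_le_trans p1. Qed.

Lemma measurable_Lp f : measurable_fun (@Rpos R) f ->
  measurable_fun (@Rpos R) (fun t => (`|f t| `^ p)%:E).
Proof.
move=> mf; apply/measurable_EFinP.
apply: (@measurableT_comp _ _ _ _ _ _ (fun x : R => x `^ p)) => //.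
exact: measurableT_comp.
Qed.

Lemma Lp_int_ge0 f : (0 <= Lp_int p f)%E.
Proof. by apply: integral_ge0 => t _; rewrite lee_fin powR_ge0. Qed.

Lemma eq_Lp_int f g : (forall t, 0 < t -> f t = g t) -> Lp_int p f = Lp_int p g.
Proof.
by move=> fg; apply: eq_integral => t; rewrite inE => /RposP/fg ->.
Qed.

Lemma le_Lp_int f g : measurable_fun (@Rpos R) f -> measurable_fun (@Rpos R) g ->
  (forall t, 0 < t -> `|f t| <= `|g t|) -> (Lp_int p f <= Lp_int p g)%E.
Proof.
move=> mf mg fg; apply: ge0_le_integral; first exact: measurable_Rpos.
- by move=> t _; rewrite lee_fin powR_ge0.
- exact: measurable_Lp.
- exact: measurable_Lp.
- by move=> t /RposP/fg h; rewrite lee_fin ge0_ler_powR ?nnegrE// ltW.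
Qed.

Lemma Lp_intZ k f : measurable_fun (@Rpos R) f ->
  Lp_int p (fun t => k * f t) = ((`|k| `^ p)%:E * Lp_int p f)%E.
Proof.
move=> mf; rewrite -ge0_integralZl.
- by apply: eq_integral => t _; rewrite normrM powRM// EFinM.
- exact: measurable_Rpos.
- exact: measurable_Lp.
- by move=> t _; rewrite lee_fin powR_ge0.
- by rewrite lee_fin powR_ge0.
Qed.

(** Pointwise, [|f + g|] is at most twice the larger of [|f|] and [|g|]. This weak form of
    Minkowski's inequality suffices for all limit arguments. *)
Lemma Lp_intD f g : measurable_fun (@Rpos R) f -> measurable_fun (@Rpos R) g ->
  (Lp_int p (fun t => f t + g t)%R <= (2 `^ p)%:E * (Lp_int p f + Lp_int p g))%E.
Proof.
move=> mf mg; rewrite /Lp_int -ge0_integralD; last 5 first.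
- exact: measurable_Rpos.
- by move=> t _; rewrite lee_fin powR_ge0.
- exact: measurable_Lp.
- by move=> t _; rewrite lee_fin powR_ge0.
- exact: measurable_Lp.
rewrite -ge0_integralZl.
- apply: ge0_le_integral.
  + exact: measurable_Rpos.
  + by move=> t _; rewrite lee_fin powR_ge0.
  + by apply: measurable_Lp; exact: measurable_funD.
  + by apply: measurable_funeM; apply: emeasurable_funD; exact: measurable_Lp.
  + move=> t _; rewrite -EFinD -EFinM lee_fin.
    wlog fg : f g mf mg / `|f t| <= `|g t|.
      move=> h; have [/h|/ltW/h] := leP `|f t| `|g t|; first exact.
      by rewrite addrC [X in _ * X]addrC; exact.
    apply: (@le_trans _ _ ((2 * `|g t|) `^ p)).
      rewrite ge0_ler_powR ?nnegrE ?mulr_ge0// ?(ltW p0)//.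
      rewrite (le_trans (ler_normD _ _))//; lra.
    by rewrite powRM// ler_wpM2l ?powR_ge0// lerDr powR_ge0.
- exact: measurable_Rpos.
- by apply: emeasurable_funD; exact: measurable_Lp.
- by move=> t _; rewrite -EFinD lee_fin addr_ge0 ?powR_ge0.
- by rewrite lee_fin powR_ge0.
Qed.

Lemma in_Lp_le f g : measurable_fun (@Rpos R) f -> in_Lp p g ->
  (forall t, 0 < t -> `|f t| <= `|g t|) -> in_Lp p f.
Proof.
move=> mf [mg Ig] fg; split; first exact: mf.
by apply: le_lt_trans Ig; exact: le_Lp_int.
Qed.

Lemma in_LpZ k f : in_Lp p f -> in_Lp p (fun t => k * f t).
Proof.
move=> [mf If]; split; first exact: measurable_funM.
by rewrite Lp_intZ// lte_mul_pinfty// lee_fin powR_ge0.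
Qed.

Lemma in_LpD f g : in_Lp p f -> in_Lp p g -> in_Lp p (fun t => f t + g t).
Proof.
move=> [mf If] [mg Ig]; split; first exact: measurable_funD.
apply: (le_lt_trans (Lp_intD mf mg)).
move: (Lp_int p f) (Lp_int p g) If Ig => A B Aoo Boo.
by rewrite lte_mul_pinfty ?lee_fin ?powR_ge0// lte_add_pinfty.
Qed.

(** The [p]-th power of [xi alpha c] is [xi (alpha * p) (c * p)], and [alpha > - p^-1] means
    [alpha * p > -1]. *)
Lemma in_Lp_xi alpha c : - p^-1 < alpha -> 0 < c -> in_Lp p (xi alpha c).
Proof.
move=> ap c0; split; first exact: measurable_xi.
have -> : Lp_int p (xi alpha c) = (\int[mu]_(t in @Rpos R) (xi (alpha * p) (c * p) t)%:E)%E.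
  apply: eq_integral => t _; rewrite ger0_norm ?mulr_ge0 ?powR_ge0 ?expR_ge0//.
  rewrite powRM ?powR_ge0 ?expR_ge0// -powRrM -expRM; congr (_ * expR _)%:E.
  by ring.
apply: integral_xi_lt_pinfty; last by rewrite mulr_gt0.
by rewrite -(mulVf (lt0r_neq0 p0)) -mulNr ltr_pM2r.
Qed.

Lemma cvg_powR0 (u : nat -> R) : u @ \oo --> 0 -> (fun n => `|u n| `^ p) @ \oo --> 0.
Proof.
move=> u0; apply/cvgrPdist_le => e e0.
move/cvgrPdist_le : u0 => /(_ (e `^ p^-1)); rewrite powR_gt0// => /(_ isT).
apply: filterS => n; rewrite !sub0r !normrN => h.
rewrite ger0_norm ?powR_ge0//.
rewrite -[leRHS](_ : (e `^ p^-1) `^ p = e).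
  by rewrite ge0_ler_powR ?nnegrE ?powR_ge0// ltW.
by rewrite -powRrM mulVf ?gt_eqF// powRr1// ltW.
Qed.

Lemma cvg_norm_le (u : nat -> R) a b :
  (forall n, `|u n| <= b) -> u @ \oo --> a -> `|a| <= b.
Proof.
move=> ub ua; have nua : `|u n| @[n --> \oo] --> `|a| by exact: cvg_norm.
rewrite -(cvg_lim _ nua)//; apply: limr_le; last exact: nearW.
by apply/cvg_ex; eexists; exact: nua.
Qed.

(** The limit inherits the bound [|g|], so the [p]-th power of [|2 * g|] dominates that of every
    difference. *)
Lemma Lp_int_dominated_cvg (f_ : nat -> R -> R) f g :
  (forall n, measurable_fun (@Rpos R) (f_ n)) -> measurable_fun (@Rpos R) f ->
  in_Lp p g -> (forall n t, 0 < t -> `|f_ n t| <= `|g t|) ->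
  (forall t, 0 < t -> f_ ^~ t @ \oo --> f t) ->
  (fun n => Lp_int p (fun t => f t - f_ n t)) @ \oo --> 0%E.
Proof.
move=> mf_ mf [mg Ig] fg cf.
have fg' t : 0 < t -> `|f t| <= `|g t|.
  by move=> t0; apply: cvg_norm_le (cf _ t0) => n; exact: fg.
pose h n t := (`|f t - f_ n t| `^ p)%:E.
have mh n : measurable_fun (@Rpos R) (h n).
  by apply: measurable_Lp; exact: measurable_funB.
have cvh : {ae mu, forall t, @Rpos R t -> h ^~ t @ \oo --> 0%E}.
  apply: aeW => t /RposP t0; apply: cvg_EFin; first exact: nearW.
  apply: cvg_powR0; rewrite -[X in _ --> X](subrr (f t)).
  by apply: cvgB; [exact: cvg_cst|exact: cf].
have ig : mu.-integrable (@Rpos R) (fun t => (`|2 * g t| `^ p)%:E).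
  apply/integrableP; split; first by apply: measurable_Lp; exact: measurable_funM.
  under eq_integral do rewrite gee0_abs ?lee_fin ?powR_ge0//.
  by have [] := in_LpZ 2 (conj mg Ig).
have hg : {ae mu, forall t n, @Rpos R t -> (`|h n t| <= (`|2 * g t| `^ p)%:E)%E}.
  apply: aeW => t n /RposP t0; rewrite /h gee0_abs ?lee_fin ?powR_ge0//.
  rewrite ge0_ler_powR ?nnegrE// ?(ltW p0)//.
  rewrite (le_trans (ler_normB _ _))// normrM ger0_norm//.
  have := fg' _ t0; have := fg n _ t0; lra.
have [_ _] := @dominated_convergence _ _ R mu _ (@measurable_Rpos R) h (cst 0%E) _
  mh (measurable_cst _) cvh ig hg.
by rewrite integral0.
Qed.

(** Continuity of addition at zero; it stands in for the triangle inequality, as [Lp_int] is the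
    [p]-th power of the norm. *)
Lemma Lp_intD_small eps : 0 < eps -> exists2 delta : R, 0 < delta &
  forall f g, measurable_fun (@Rpos R) f -> measurable_fun (@Rpos R) g ->
  (Lp_int p f < delta%:E -> Lp_int p g < delta%:E ->
   Lp_int p (fun t => f t + g t)%R < eps%:E)%E.
Proof.
move=> e0; have pw : 0 < 2 `^ p :> R by rewrite powR_gt0.
exists (eps / (2 `^ p * 2)); first by rewrite divr_gt0// mulr_gt0.
move=> f g mf mg fd gd; apply: (le_lt_trans (Lp_intD mf mg)).
have -> : eps = 2 `^ p * (eps / (2 `^ p * 2) + eps / (2 `^ p * 2)) by field; rewrite gt_eqF.
by rewrite EFinM lte_pmul2l ?lte_fin// EFinD lteD.
Qed.

Lemma Lp_intZ_small k eps : 0 < eps -> exists2 delta : R, 0 < delta &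
  forall f, measurable_fun (@Rpos R) f ->
  (Lp_int p f < delta%:E -> Lp_int p (fun t => k * f t)%R < eps%:E)%E.
Proof.
move=> e0; have pw : 0 < `|k| `^ p + 1 by rewrite ltr_pwDr// powR_ge0.
exists (eps / (`|k| `^ p + 1)); first by rewrite divr_gt0.
move=> f mf fd; rewrite Lp_intZ//.
apply: (@le_lt_trans _ _ ((`|k| `^ p + 1)%:E * Lp_int p f)%E).
  by rewrite lee_wpmul2r ?Lp_int_ge0// lee_fin lerDl.
have -> : eps = (`|k| `^ p + 1) * (eps / (`|k| `^ p + 1)) by field; rewrite gt_eqF.
by rewrite EFinM lte_pmul2l ?lte_fin.
Qed.

End LpInt.

(** * Expansion of [xi] in Laguerre functions *)

Section LaguerreExpansion.
Variables (R : realType) (p alpha : R).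
Hypotheses (p1 : 1 <= p) (alpha_gt : - p^-1 < alpha).
Implicit Types (t s k lambda eps c : R) (f g : R -> R) (n N : nat).

Let p0 : 0 < p. Proof. exact: lt_le_trans p1. Qed.

(** Since [p >= 1], the assumption gives [alpha > -1]. *)
Lemma Gamma_laguerre_gt0 n : 0 < Gamma (n%:R + alpha + 1).
Proof.
apply: Gamma_gt0; rewrite -addrA ltr_wpDl// -ltrBlDr sub0r.
by rewrite (le_lt_trans _ alpha_gt)// lerN2 invf_le1.
Qed.

Lemma laguerre_fnE n t : laguerre_fn n alpha t =
  (n`!)%:R / Gamma (n%:R + alpha + 1) * (xi alpha 1 t * (laguerre_poly alpha n).[t]).
Proof. by rewrite /laguerre_fn /xi laguerre_polyE mul1r !mulrA. Qed.

Lemma measurable_horner (q : {poly R}) (D : set R) : measurable_fun D (horner q).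
Proof.
by apply: measurable_funTS; apply: continuous_measurable_fun; exact: continuous_horner.
Qed.

Lemma measurable_laguerre_fn n : measurable_fun (@Rpos R) (laguerre_fn n alpha).
Proof.
apply: (eq_measurable_fun (fun t =>
  (n`!)%:R / Gamma (n%:R + alpha + 1) * (xi alpha 1 t * (laguerre_poly alpha n).[t]))).
  by move=> t _; rewrite laguerre_fnE.
apply: measurable_funM => //; apply: measurable_funM; first exact: measurable_xi.
exact: measurable_horner.
Qed.

(** The bound [C * expR (t / 2)] on [L_n] still leaves the decay [expR (- (t / 2))]. *)
Lemma in_Lp_laguerre_fn n : in_Lp p (laguerre_fn n alpha).
Proof.
have [C C0 hC] := laguerreL_le alpha n.
set K := (n`!)%:R / Gamma (n%:R + alpha + 1).
apply: (@in_Lp_le _ _ p1 _ (fun t => K * C * xi alpha 2^-1 t)).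
- exact: measurable_laguerre_fn.
- by apply: in_LpZ => //; exact: in_Lp_xi.
- move=> t t0; rewrite laguerre_fnE -/K normrM -mulrA [leRHS]normrM ler_wpM2l//.
  rewrite laguerre_polyE (normrM (xi alpha 1 t)) mulrC.
  apply: (le_trans (ler_wpM2r (normr_ge0 _) (hC _ (ltW t0)))).
  have xi0 c : 0 <= xi alpha c t by rewrite mulr_ge0 ?powR_ge0 ?expR_ge0.
  rewrite (normrM C) (ger0_norm C0) !(ger0_norm (xi0 _)) /xi le_eqVlt; apply/orP; left; apply/eqP.
  have -> : expR (- (2^-1 * t)) = expR (t / 2) * expR (- (1 * t)).
    by rewrite -expRD; congr expR; field.
  ring.
Qed.

(** The factor [Gamma / n!] cancels the normalization of [laguerre_fn], and the power of
    [lambda + 1] splits into the denominator of [z ^ n] and a factor independent of [n]. *)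
Lemma laguerre_expansion_remainder lambda N t : 0 < lambda ->
  xi alpha (lambda + 1) t -
    \sum_(n < N) (lambda ^+ n / (lambda + 1) `^ (n%:R + alpha + 1)
                  * (Gamma (n%:R + alpha + 1) / (n`!)%:R)) * laguerre_fn n alpha t =
  xi alpha 1 t * (expR (- (lambda * t)) - (lambda + 1) `^ (- (alpha + 1)) *
    (laguerre_gen alpha (lambda / (lambda + 1)) N).[t]).
Proof.
move=> l0; have l1 : 0 < lambda + 1 by rewrite addr_gt0.
rewrite mulrBr; congr (_ - _).
  by rewrite /xi -mulrA -expRD; congr (_ * expR _); ring.
rewrite /laguerre_gen horner_sum !mulr_sumr; apply: eq_bigr => n _.
rewrite laguerre_fnE hornerZ.
have -> : (lambda + 1) `^ (n%:R + alpha + 1) = (lambda + 1) ^+ n * (lambda + 1) `^ (alpha + 1).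
  rewrite -addrA (@powRD _ _ n%:R); first by rewrite powR_mulrn// ltW.
  by rewrite (gt_eqF l1) implybT.
rewrite powRN expr_div_n.
have h1 : Gamma (n%:R + alpha + 1) != 0 by rewrite gt_eqF// Gamma_laguerre_gt0.
have h2 : (n`!)%:R != 0 :> R by rewrite pnatr_eq0 -lt0n fact_gt0.
have h3 : (lambda + 1) `^ (alpha + 1) != 0 by rewrite gt_eqF// powR_gt0.
have h4 : lambda + 1 != 0 by rewrite gt_eqF.
by field; rewrite h1 h2 h3 ?h4 expf_neq0.
Qed.

(** The growth [expR (3 / 4 * t)] of the remainder against [expR (- t)] leaves [|eta N|] times the
    fixed function [xi alpha 4^-1] of [L^p]. *)
Lemma laguerre_expansion_cvg lambda : 0 < lambda ->
  (fun N => Lp_int p (fun t => xi alpha (lambda + 1) t -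
    \sum_(n < N) (lambda ^+ n / (lambda + 1) `^ (n%:R + alpha + 1)
                  * (Gamma (n%:R + alpha + 1) / (n`!)%:R)) * laguerre_fn n alpha t))
    @ \oo --> 0%E.
Proof.
move=> l0; have [eta eta0 heta] := laguerre_gen_cvg alpha l0.
have [mxi Ixi] : in_Lp p (xi alpha 4^-1) by exact: in_Lp_xi.
have fin : Lp_int p (xi alpha 4^-1) \is a fin_num by rewrite ge0_fin_numE// Lp_int_ge0.
apply: (@squeeze_cvge _ _ _ _ (fun=> 0%E) _
  (fun N => (`|eta N| `^ p)%:E * Lp_int p (xi alpha 4^-1)))%E.
- apply: nearW => N; rewrite Lp_int_ge0 /= -Lp_intZ//.
  rewrite (eq_Lp_int _ (fun t _ => laguerre_expansion_remainder N t l0)).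
  apply: le_Lp_int => //.
  + apply: measurable_funM; first exact: measurable_xi.
    apply: measurable_funB; last by apply: measurable_funM => //; exact: measurable_horner.
    (* With exponent [0], [xi] is the bare exponential. *)
    have := @measurable_xi R 0 lambda; rewrite /xi.
    by under eq_fun do rewrite powRr0 mul1r.
  + exact: measurable_funM.
  + move=> t t0; rewrite (normrM (xi alpha 1 t)).
    apply: (le_trans (ler_wpM2l (normr_ge0 _) (heta N _ (ltW t0)))).
    have xi0 c : 0 <= xi alpha c t by rewrite mulr_ge0 ?powR_ge0 ?expR_ge0.
    rewrite (normrM (eta N)) !(ger0_norm (xi0 _)).
    have -> : xi alpha 4^-1 t = xi alpha 1 t * expR (3 / 4 * t).
      by rewrite /xi -mulrA -expRD; congr (_ * expR _); field.
    by rewrite mulrCA ler_wpM2r ?ler_norm// mulr_ge0 ?expR_ge0.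
- exact: cvg_cst.
- rewrite -[X in _ --> X](mul0e (Lp_int p (xi alpha 4^-1))); apply: cvgeM => //.
  + exact: mule_def_fin.
  + by apply: cvg_EFin; [exact: nearW|exact: cvg_powR0].
  + exact: cvg_cst.
Qed.

End LaguerreExpansion.

(** * The closed linear span of a sequence in [L^p] *)

Section LpClosure.
Variables (R : realType) (p : R) (e : nat -> R -> R).
Hypotheses (p1 : 1 <= p) (e_Lp : forall n, in_Lp p (e n)).
Implicit Types (t k eps : R) (f g : R -> R) (n N : nat) (q r : {poly R}).

(* Coefficient families of finite linear combinations are encoded as
   polynomials, so that two of them can be added without aligning lengths. *)
Definition lin_comb q t := \sum_(i < size q) q`_i * e i t.

Definition Lp_closure f := in_Lp p f /\
  forall eps, 0 < eps -> exists q, (Lp_int p (fun t => f t - lin_comb q t)%R < eps%:E)%E.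

Lemma lin_comb_wide N q t : (size q <= N)%N ->
  lin_comb q t = \sum_(i < N) q`_i * e i t.
Proof.
move=> sN; rewrite /lin_comb (big_ord_widen N (fun i => q`_i * e i t))// big_mkcond.
apply: eq_bigr => i _; case: ltnP => // qi.
by rewrite nth_default ?mul0r.
Qed.

Lemma lin_combD q r t : lin_comb (q + r) t = lin_comb q t + lin_comb r t.
Proof.
pose N := maxn (size q) (size r).
rewrite !(@lin_comb_wide N) ?leq_maxl ?leq_maxr ?size_polyD//.
by rewrite -big_split; apply: eq_bigr => i _; rewrite coefD mulrDl.
Qed.

Lemma lin_combZ k q t : lin_comb (k *: q) t = k * lin_comb q t.
Proof.
rewrite !(@lin_comb_wide (size q)) ?size_scale_leq// mulr_sumr.
by apply: eq_bigr => i _; rewrite coefZ mulrA.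
Qed.

Lemma lin_combXn n t : lin_comb 'X^n t = e n t.
Proof.
rewrite /lin_comb size_polyXn big_ord_recr /= coefXn eqxx mul1r big1 ?add0r// => i _.
by rewrite coefXn ltn_eqF// mul0r.
Qed.

Lemma measurable_lin_comb q : measurable_fun (@Rpos R) (lin_comb q).
Proof.
apply: measurable_sum => i; apply: measurable_funM => //.
by have [] := e_Lp i.
Qed.

Lemma eq_Lp_closure f g : (forall t, 0 < t -> f t = g t) -> Lp_closure f -> Lp_closure g.
Proof.
move=> fg [[mf If] cf]; split.
  split; last by rewrite -(eq_Lp_int _ fg).
  by apply: eq_measurable_fun mf => t; rewrite inE => /RposP/fg.
move=> eps /cf[q hq]; exists q; move: hq.
by rewrite (@eq_Lp_int _ _ _ (fun t => g t - lin_comb q t))// => t /fg ->.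
Qed.

Lemma Lp_closureD f g : Lp_closure f -> Lp_closure g -> Lp_closure (fun t => f t + g t).
Proof.
move=> [fL cf] [gL cg]; split; first exact: in_LpD.
move=> eps eps0; have [d d0 hd] := Lp_intD_small p1 eps0.
have [q hq] := cf _ d0; have [r hr] := cg _ d0; exists (q + r).
have {hd}/(_ hq hr) := hd _ _ (measurable_funB fL.1 (measurable_lin_comb q))
  (measurable_funB gL.1 (measurable_lin_comb r)).
rewrite (@eq_Lp_int _ _ _ (fun t => f t + g t - lin_comb (q + r) t))// => t _.
by rewrite lin_combD /=; ring.
Qed.

Lemma Lp_closureZ k f : Lp_closure f -> Lp_closure (fun t => k * f t).
Proof.
move=> [fL cf]; split; first exact: in_LpZ.
move=> eps eps0; have [d d0 hd] := Lp_intZ_small p k eps0.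
have [q hq] := cf _ d0; exists (k *: q).
have {hd}/(_ hq) := hd _ (measurable_funB fL.1 (measurable_lin_comb q)).
rewrite (@eq_Lp_int _ _ _ (fun t => k * f t - lin_comb (k *: q) t))// => t _.
by rewrite lin_combZ /=; ring.
Qed.

Lemma Lp_closureB f g : Lp_closure f -> Lp_closure g -> Lp_closure (fun t => f t - g t).
Proof.
move=> cf /(Lp_closureZ (-1)) cg.
by apply: eq_Lp_closure (Lp_closureD cf cg) => t _; rewrite mulN1r.
Qed.

Lemma Lp_closure_gen n : Lp_closure (e n).
Proof.
split => // eps eps0; exists 'X^n.
rewrite (@eq_Lp_int _ _ _ (fun=> 0)); last by move=> t _; rewrite lin_combXn subrr.
rewrite /Lp_int; under eq_integral do rewrite normr0 powR0 ?gt_eqF ?(lt_le_trans ltr01)//.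
by rewrite integral0 lte_fin.
Qed.

Lemma Lp_closure0 : Lp_closure (fun=> 0).
Proof.
by apply: eq_Lp_closure (Lp_closureZ 0 (Lp_closure_gen 0)) => t _; rewrite mul0r.
Qed.

Lemma Lp_closure_sum (I : Type) (s : seq I) (F : I -> R -> R) :
  (forall i, Lp_closure (F i)) -> Lp_closure (fun t => \sum_(i <- s) F i t).
Proof.
move=> cF; elim: s => [|i s ih].
  by apply: eq_Lp_closure Lp_closure0 => t _; rewrite big_nil.
by apply: eq_Lp_closure (Lp_closureD (cF i) ih) => t _; rewrite big_cons.
Qed.

Lemma Lp_closure_cvg (f_ : nat -> R -> R) f : in_Lp p f ->
  (forall n, Lp_closure (f_ n)) ->
  (fun n => Lp_int p (fun t => f t - f_ n t)) @ \oo --> 0%E -> Lp_closure f.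
Proof.
move=> fL cf_ cv; split => // eps eps0.
have [d d0 hd] := Lp_intD_small p1 eps0.
have [n hn] : exists n, (Lp_int p (fun t => f t - f_ n t)%R < d%:E)%E.
  have : nbhs 0%E [set x : \bar R | x < d%:E]%E.
    by apply: open_nbhs_nbhs; split; [exact: open_ereal_lt_ereal|rewrite /= lte_fin].
  by move=> /cv[n _ /(_ n (leqnn n)) hn]; exists n.
have [q hq] := (cf_ n).2 _ d0; exists q.
have {hd}/(_ hn hq) := hd _ _ (measurable_funB fL.1 (cf_ n).1.1)
  (measurable_funB (cf_ n).1.1 (measurable_lin_comb q)).
rewrite (@eq_Lp_int _ _ _ (fun t => f t - lin_comb q t))// => t _ /=.
by rewrite addrA subrK.
Qed.

(** The form in which limits enter the density proof: pointwise convergence under an [L^p]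
    majorant. *)
Lemma Lp_closure_dominated (f_ : nat -> R -> R) f g :
  (forall n, Lp_closure (f_ n)) -> measurable_fun (@Rpos R) f -> in_Lp p g ->
  (forall n t, 0 < t -> `|f_ n t| <= `|g t|) ->
  (forall t, 0 < t -> f_ ^~ t @ \oo --> f t) -> Lp_closure f.
Proof.
move=> cf_ mf gL fg cf.
have fg' t : 0 < t -> `|f t| <= `|g t|.
  by move=> t0; apply: cvg_norm_le (cf _ t0) => n; exact: fg.
apply: (@Lp_closure_cvg f_) => //; first exact: in_Lp_le gL fg'.
by apply: (Lp_int_dominated_cvg p1 (g := g)) => // n; exact: (cf_ n).1.1.
Qed.

End LpClosure.

(** * Polynomials approximating a step function on the unit interval *)

Section StepApproximation.
Variable R : realType.
Implicit Types (x y : R) (n m : nat).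

Lemma bernoulli_onem y m : 0 <= y <= 1 -> 1 - m%:R * y <= (1 - y) ^+ m.
Proof.
move=> /andP[y0 y1]; elim: m => [|m ih]; first by rewrite mul0r subr0.
rewrite exprS; apply: le_trans (ler_wpM2l _ ih); last by rewrite subr_ge0.
have m0 : 0 <= m%:R * (y * y) by rewrite !mulr_ge0.
by rewrite -natr1; nra.
Qed.

(** Induction on [m] from [(1 - y) * (1 + m.+1 * y) <= 1 + m * y]. With [bernoulli_onem] it encloses
    the step polynomials from both sides. *)
Lemma onem_expn_le_inv y m : 0 <= y <= 1 -> (1 - y) ^+ m <= (1 + m%:R * y)^-1.
Proof.
move=> /andP[y0 y1].
have pos k : 0 < 1 + k%:R * y by rewrite ltr_pwDl// mulr_ge0.
rewrite -[leRHS]mul1r ler_pdivlMr//.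
elim: m => [|m ih]; first by rewrite mul0r addr0 mulr1.
apply: le_trans ih; rewrite exprSr -mulrA ler_wpM2l ?exprn_ge0 ?subr_ge0//.
have m0 : 0 <= m%:R * (y * y) by rewrite !mulr_ge0.
by rewrite -natr1; nra.
Qed.

Lemma sum_indic_trivIset (T : Type) (F : nat -> set T) k0 n t :
  trivIset [set: nat] F -> F k0 t -> \sum_(k < n) \1_(F k) t = (k0 < n)%N%:R :> R.
Proof.
move=> tF Ft.
have -> : \sum_(k < n) \1_(F k) t = \sum_(k < n) (k == k0 :> nat)%:R :> R.
  apply: eq_bigr => k _; rewrite indicE; congr (nat_of_bool _)%:R.
  apply/idP/eqP => [/set_mem Fk|->]; last exact/mem_set.
  by apply: tF => //; exists t.
have [k0n|nk0] := ltnP k0 n.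
  rewrite (bigD1 (Ordinal k0n))//= eqxx big1 ?addr0// => k.
  by rewrite -val_eqE /= => /negPf ->.
by rewrite big1// => k _; rewrite ltn_eqF// (leq_trans _ nk0).
Qed.

(** The factor [2 ^ n] puts the threshold at [x = 1 / 2], because [2 ^ n * x ^ n = (2 * x) ^ n]. *)
Definition step_poly n : {poly R} := (1 - 'X^n) ^+ (n * 2 ^ n).

Lemma step_poly_itv n x : 0 <= x <= 1 -> 0 <= (step_poly n).[x] <= 1.
Proof.
move=> /andP[x0 x1]; rewrite /step_poly !hornerE.
have h : 0 <= 1 - x ^+ n <= 1.
  by rewrite subr_ge0 exprn_ile1//= gerBl exprn_ge0.
by case/andP: h => h0 h1; rewrite exprn_ge0// exprn_ile1.
Qed.

(* The exponent [n * 2 ^ n] instead of [2 ^ n] makes the limit [0], not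
   [expR (- 1)], at the jump [x = 1 / 2]. *)
Lemma step_poly_cvg x : 0 < x <= 1 ->
  (fun n => (step_poly n).[x]) @ \oo --> ((x < 2^-1)%R%:R : R).
Proof.
move=> /andP[x0 x1]; have hx : 0 <= x <= 1 by rewrite ltW.
have xn n : 0 <= x ^+ n <= 1 by rewrite exprn_ge0 ?exprn_ile1 ?(ltW x0).
have my n : (n * 2 ^ n)%:R * x ^+ n = n%:R * (2 * x) ^+ n.
  by rewrite natrM natrX exprMn mulrA.
have [xlt|xge] := ltP x 2^-1.
  (* Below the threshold, Bernoulli's inequality gives the lower bound [1 - n * (2 * x) ^ n]; [n] is
     weakened to [n.+1] to match [expn_geometric_cvg0]. *)
  apply: (@squeeze_cvgr _ _ _ _ (fun n => 1 - n.+1%:R ^+ 1 * (2 * x) ^+ n) (fun=> 1)).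
  - apply: nearW => n; apply/andP; split; last first.
      by case/andP: (step_poly_itv n hx).
    rewrite /step_poly !hornerE; apply: le_trans (bernoulli_onem _ (xn n)).
    rewrite my lerD2l lerN2 ler_wpM2r ?exprn_ge0 ?mulr_ge0 ?(ltW x0)//.
    by rewrite ler_nat.
  - rewrite -[X in _ --> X]subr0; apply: cvgB; first exact: cvg_cst.
    by apply: expn_geometric_cvg0; lra.
  - exact: cvg_cst.
(* From the threshold on, [(2 * x) ^ n >= 1], so [onem_expn_le_inv] gives at most [1 / (1 + n)]. *)
apply: (@squeeze_cvgr _ _ _ _ (fun=> 0) (fun n => n.+1%:R^-1)).
- apply: nearW => n; apply/andP; split.
    by case/andP: (step_poly_itv n hx).
  rewrite /step_poly !hornerE; apply: (le_trans (onem_expn_le_inv _ (xn n))).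
  rewrite lef_pV2 ?posrE//; last first.
    by rewrite ltr_pwDl// mulr_ge0//; case/andP: (xn n).
  rewrite my -natr1 addrC lerD2l ler_peMr// exprn_ege1//; lra.
- exact: cvg_cst.
- exact: cvg_harmonic.
Qed.

End StepApproximation.

(** * Density of the span of the Laguerre functions *)

Section LaguerreDense.
Import HBNNSimple.
Variables (R : realType) (p alpha : R).
Hypotheses (p1 : 1 <= p) (alpha_gt : - p^-1 < alpha).
Implicit Types (t k c l lambda eps : R) (f g : R -> R) (n N : nat) (A : set R).

Let e n := laguerre_fn n alpha.
Local Notation closure := (Lp_closure p e).
Let w := xi alpha 1.

Let e_Lp n : in_Lp p (e n). Proof. exact: in_Lp_laguerre_fn. Qed.

Let w_Lp : in_Lp p w. Proof. by apply: in_Lp_xi. Qed.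

Let w_ge0 t : 0 <= w t. Proof. by rewrite mulr_ge0 ?powR_ge0 ?expR_ge0. Qed.

(** [L_0 = 1], so the weight is a multiple of the first Laguerre function. *)
Lemma Lp_closure_weight : closure w.
Proof.
apply: (eq_Lp_closure _ (Lp_closureZ e_Lp (Gamma (alpha + 1)) (Lp_closure_gen p1 e_Lp 0))).
move=> t _; rewrite /e laguerre_fnE fact0 mul1r add0r.
have G0 : Gamma (alpha + 1) != 0.
  by have := Gamma_laguerre_gt0 p1 alpha_gt 0; rewrite add0r => /lt0r_neq0.
rewrite mulrA mulfV// mul1r.
have -> : laguerre_poly alpha 0 = 1; last by rewrite hornerC mulr1.
by apply/polyP => i; rewrite coef_poly coef1; case: i => //=; rewrite expr0 gbinom0 fact0 divr1 mulr1.
Qed.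

Lemma Lp_closure_xi lambda : 0 <= lambda -> closure (xi alpha (lambda + 1)).
Proof.
rewrite le_eqVlt => /predU1P[<-|l0].
  by rewrite add0r; exact: Lp_closure_weight.
apply: (Lp_closure_cvg p1 e_Lp _ _ (laguerre_expansion_cvg p1 alpha_gt l0)).
  by apply: in_Lp_xi => //; rewrite addr_gt0.
move=> N; apply: (Lp_closure_sum p1 e_Lp) => n.
by apply: (Lp_closureZ e_Lp); exact: (Lp_closure_gen p1 e_Lp).
Qed.

(** The monomial of degree [i] in [expR (- (l * t))] turns the weight into [xi alpha (i * l + 1)],
    which the expansion puts in the closed span. *)
Lemma Lp_closure_poly_expR l (q : {poly R}) : 0 <= l ->
  closure (fun t => w t * q.[expR (- (l * t))]).
Proof.
move=> l0.
apply: (eq_Lp_closure (f := fun t => \sum_(i < size q) q`_i * xi alpha (i%:R * l + 1) t)).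
  move=> t _; rewrite horner_coef mulr_sumr; apply: eq_bigr => i _.
  have -> : xi alpha (i%:R * l + 1) t = w t * expR (- (l * t)) ^+ i; last by rewrite mulrCA.
  by rewrite /w /xi -mulrA -expRM_natl -expRD; congr (_ * expR _); ring.
apply: (Lp_closure_sum p1 e_Lp) => i; apply: (Lp_closureZ e_Lp).
by apply: Lp_closure_xi; rewrite mulr_ge0.
Qed.

Let measurable_w_indic A : measurable A -> measurable_fun (@Rpos R) (fun t => w t * \1_A t).
Proof.
move=> mA; apply: measurable_funM; first exact: measurable_xi.
exact: measurable_indic.
Qed.

Lemma Lp_closure_ray c : closure (fun t => w t * \1_(`]c, +oo[%classic) t).
Proof.
have [c0|c0] := leP c 0.
  apply: (eq_Lp_closure _ Lp_closure_weight) => t t0.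
  by rewrite indicE mem_set ?mulr1//= in_itv/= andbT (le_lt_trans c0).
(* Chosen so that [expR (- (l * t)) < 1 / 2] exactly when [t > c]. *)
pose l := ln 2 / c.
have ln2 : 0 < ln 2 :> R by rewrite ln_gt0// ltr1n.
have l0 : 0 < l by rewrite divr_gt0.
have x01 t : 0 < t -> 0 < expR (- (l * t)) <= 1.
  by move=> t0; rewrite expR_gt0/= -[leRHS]expR0 ler_expR oppr_le0 mulr_ge0 ?ltW.
apply: (Lp_closure_dominated p1 e_Lp (g := w)
  (f_ := fun n t => w t * (step_poly R n).[expR (- (l * t))])).
- by move=> n; apply: Lp_closure_poly_expR; exact: ltW.
- exact: measurable_w_indic.
- exact: w_Lp.
- move=> n t t0; rewrite normrM -[leRHS]mulr1 ler_wpM2l//.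
  have /andP[x0 x1] := x01 _ t0.
  have /andP[s0 s1] : 0 <= (step_poly R n).[expR (- (l * t))] <= 1.
    by apply: step_poly_itv; rewrite ltW.
  by rewrite ger0_norm.
- move=> t t0; apply: cvgMr => //.
  have -> : \1_(`]c, +oo[%classic) t = (expR (- (l * t)) < 2^-1)%R%:R :> R.
    rewrite indicE; congr (nat_of_bool _)%:R.
    have -> : 2^-1 = expR (- ln 2) :> R by rewrite expRN lnK// posrE.
    rewrite ltr_expR ltrN2 /l mulrAC ltr_pdivlMr// ltr_pM2l//.
    by apply/idP/idP => [/set_mem|h]; [|apply/mem_set]; rewrite /= in_itv/= andbT.
  exact: step_poly_cvg (x01 _ t0).
Qed.

(** Open rays are stable under intersection and generate the Borel sets. Complements are handled by
    subtraction from the weight, disjoint countable unions by domination by the weight. *)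
Lemma Lp_closure_indic A : measurable A -> closure (fun t => w t * \1_A t).
Proof.
move=> mA.
have mE : @measurable _ (measurableTypeR R) = <<s @RGenOInfty.G R >> := RGenOInfty.measurableE R.
apply: (@dynkin_induction _ (measurableTypeR R) (@RGenOInfty.G R)
  (fun A => closure (fun t => w t * \1_A t)) mE).
- move=> _ _ [x ->] [y ->]; exists (Num.max x y).
  apply/seteqP; split => t /=; rewrite !in_itv/= !andbT gt_max.
    by case=> -> ->.
  by move=> /andP[].
- apply: (eq_Lp_closure _ Lp_closure_weight) => t _.
  by rewrite indicE in_setT mulr1.
- by move=> _ [x ->]; exact: Lp_closure_ray.
- move=> S _ cS.
  apply: (eq_Lp_closure _ (Lp_closureB p1 e_Lp Lp_closure_weight cS)) => t _.
  by rewrite !indicE in_setC; case: (t \in S); rewrite /= ?mulr1 ?mulr0 ?subrr ?subr0.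
- move=> F mF tF cF.
  apply: (Lp_closure_dominated p1 e_Lp (g := w)
    (f_ := fun n t => \sum_(k < n) w t * \1_(F k) t)).
  + by move=> n; apply: (Lp_closure_sum p1 e_Lp) => k; exact: cF.
  + by apply: measurable_w_indic; exact: bigcupT_measurable.
  + exact: w_Lp.
  + move=> n t _; rewrite -mulr_sumr normrM -[leRHS]mulr1 ler_wpM2l//.
    have [[k0 Fk]|nF] := pselect (exists k0 : nat, F k0 t).
      by rewrite (sum_indic_trivIset _ _ tF Fk); case: ltnP => _; rewrite ?normr1 ?normr0.
    rewrite big1 ?normr0// => k _; rewrite indicE memNset// => Fk.
    by apply: nF; exists k.
  + move=> t _.
    under eq_fun do rewrite -mulr_sumr.
    apply: cvgMr => //.
    have [[k0 Fk]|nF] := pselect (exists k0 : nat, F k0 t).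
      rewrite indicE mem_set; last by exists k0.
      apply: cvg_near_cst; exists k0.+1 => // n /= k0n.
      by rewrite (sum_indic_trivIset _ _ tF Fk) k0n.
    rewrite indicE memNset; last by move=> [k _ Fk]; apply: nF; exists k.
    apply: cvg_near_cst; apply: nearW => n; rewrite big1// => k _.
    by rewrite indicE memNset// => Fk; apply: nF; exists k.
- by rewrite -mE.
Qed.

(** The quotient [h] of [f] by the weight is an increasing limit of simple functions; their products
    with the weight lie in the closed span and are dominated by [f]. *)
Lemma Lp_closure_nonneg f : in_Lp p f -> (forall t, 0 <= f t) -> closure f.
Proof.
move=> fL f0.
(* For [t > 0], [xi (- alpha) (-1) t] is the inverse of [w t]. *)
pose h t := (f t * xi (- alpha) (-1) t)%:E.
have mh : measurable_fun (@Rpos R) h.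
  by apply/measurable_EFinP; apply: measurable_funM; [exact: fL.1|exact: measurable_xi].
have h0 t : @Rpos R t -> (0 <= h t)%E.
  by move=> _; rewrite lee_fin !mulr_ge0 ?powR_ge0 ?expR_ge0.
have wh t : 0 < t -> w t * fine (h t) = f t.
  move=> t0; rewrite /h/= mulrCA /w /xi mulrACA -powRD ?subrr ?powRr0; last first.
    by rewrite (gt_eqF t0) implybT.
  by rewrite -expRD mulN1r opprK mul1r addNr expR0 !mulr1.
pose a_ := nnsfun_approx (@measurable_Rpos R) mh.
apply: (Lp_closure_dominated p1 e_Lp (g := f) (f_ := fun n t => w t * a_ n t)).
- move=> n.
  suff : closure (fun t : R =>
      \sum_(y <- finmap.enum_fset (fset_set (range (a_ n)))) y * (w t * \1_(a_ n @^-1` [set y]) t)).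
    apply: eq_Lp_closure => t _; rewrite [in RHS](fimfunE (a_ n)) fsbig_finite//= mulr_sumr.
    by apply: eq_bigr => y _; rewrite mulrCA.
  apply: (Lp_closure_sum p1 e_Lp) => y; apply: (Lp_closureZ e_Lp).
  exact: Lp_closure_indic.
- exact: fL.1.
- exact: fL.
- move=> n t t0; rewrite (ger0_norm (f0 t)) -(wh _ t0).
  rewrite ger0_norm; last by apply: mulr_ge0 => //; exact: fun_ge0.
  apply: ler_wpM2l; first exact: w_ge0.
  by rewrite -lee_fin /a_ nnsfun_approxE; apply: le_approx => //; exact/RposP.
- move=> t t0; rewrite -(wh _ t0); apply: cvgMr => //.
  have := cvg_nnsfun_approx (@measurable_Rpos R) mh h0 (_ : @Rpos R t).
  by move=> /(_ _)/fine_cvg; apply; exact/RposP.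
Qed.

(** Positive and negative parts reduce this to the nonnegative case. *)
Lemma laguerre_dense f : in_Lp p f -> closure f.
Proof.
move=> fL.
have [fp fn] : in_Lp p (fun t => Num.max (f t) 0) /\ in_Lp p (fun t => Num.max (- f t) 0).
  split; apply: (in_Lp_le p1 _ fL).
  - by apply: measurable_maxr => //; exact: fL.1.
  - move=> t _; rewrite ger0_norm ?le_max ?lexx ?orbT//.
    by rewrite ge_max ler_norm normr_ge0.
  - by apply: measurable_maxr => //; apply: measurableT_comp => //; exact: fL.1.
  - move=> t _; rewrite ger0_norm ?le_max ?lexx ?orbT//.
    by rewrite ge_max -normrN ler_norm normr_ge0.
have max0 (g : R -> R) t : 0 <= Num.max (g t) 0 by rewrite le_max lexx orbT.
apply: (eq_Lp_closure _ (Lp_closureB p1 e_Lp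
  (Lp_closure_nonneg fp (max0 _)) (Lp_closure_nonneg fn (max0 (fun t => - f t))))).
move=> t _; case: (leP 0 (f t)) => h.
  by rewrite max_r ?subr0// oppr_le0.
by rewrite max_l ?opprK ?add0r// oppr_ge0 ltW.
Qed.

End LaguerreDense.

(** * The expansion and the density, brought together *)

Theorem theorem3p1 (R : realType) (p : R) (hp : 1 <= p) :
  (* (i) *)
  (forall alpha lambda : R, - p^-1 < alpha -> 0 < lambda ->
     in_Lp p (xi alpha (lambda + 1)) /\
     (forall n : nat, in_Lp p (laguerre_fn n alpha)) /\
     ((fun N : nat =>
        Lp_int p (fun t => xi alpha (lambda + 1) t -
          \sum_(n < N) (lambda ^+ n / (lambda + 1) `^ (n%:R + alpha + 1)
                        * (Gamma (n%:R + alpha + 1) / (n`!)%:R))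
                       * laguerre_fn n alpha t))
       @ \oo --> 0%E)) /\
  (* (ii) *)
  (forall alpha : R, - p^-1 < alpha ->
     forall f : R -> R, in_Lp p f ->
     forall eps : R, 0 < eps ->
     exists (N : nat) (c : nat -> R),
       Order.lt (Lp_int p (fun t => f t - \sum_(n < N) c n * laguerre_fn n alpha t))
          (eps%:E)).
Proof.
split=> [alpha lambda ap l0|alpha ap f fL eps eps0].
  split; first by apply: in_Lp_xi => //; rewrite addr_gt0.
  split; first by move=> n; exact: in_Lp_laguerre_fn.
  exact: laguerre_expansion_cvg.
have [_ /(_ _ eps0)[q hq]] := laguerre_dense hp ap fL.
(* The approximating polynomial is read back as its list of coefficients. *)
by exists (size q), (fun n => q`_n).
Qed.
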